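(* Consider a reduced constrained pairwise covering problem. Suppose that a subset of parameters $P$ (i) has a coherent partition of parameters $(P_0,P_1)$, and (ii) induces a sparse split constraint graph $G[P]$ with partitions $(P_C,P_U)$, where $n:=|P_C|\geq 3$ and $m:=|P_U|\geq 1$. Then for any valid covering array with $N$ tests, $$N\geq 2n+\alpha,$$ where $2n+\alpha$, $\alpha\geq 0$, is the smallest number of rows such that (a) there are $m$ columns defining a valid (unconstrained pairwise) covering array on the parameters in $P_U$; and (b) the rows (tests) of that covering array can be partitioned into $n$ subsets, each of which contains a test with $X_i=0$ and a test with $X_i=1$ for each parameter $X_i\in P_U$. Moreover, $$w_i\geq 2(n-1)\quad\forall X_i\in P_C\cap P_0,$$ $$w_i\leq N-2(n-1)\quad\forall X_i\in P_C\cap P_1,$$ $$\sum_{X_i\in P_C\cap P_0}w_i+\sum_{X_i\in P_C\cap P_1}(N-w_i)\geq(2n+\alpha)(n-1),$$ where $w_i$ is the number of ones in the column of $X_i\in P_C$ in any such valid covering array.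
   Context: A constrained pairwise covering problem consists of binary parameters $X_1,\dots,X_k$ and a set of pairwise constraints, each of the form $(X_i,X_j)\neq(\alpha,\beta)$ with $i\neq j$ and $\alpha,\beta\in\{0,1\}$. An assignment $x\in\{0,1\}^k$ is feasible if it satisfies all constraints. A pairwise assignment $(X_i,X_j)=(\alpha,\beta)$ is forbidden if no feasible $x$ has $(x_i,x_j)=(\alpha,\beta)$, i.e., if the constraint $(X_i,X_j)\neq(\alpha,\beta)$ is explicitly given or implied by the other constraints; in either case it is counted as a pairwise constraint of the problem. The problem is reduced if (i) no parameter has a fixed value (explicitly or by implication), i.e., each $X_i$ takes both values among feasible assignments, and (ii) there is at most one pairwise constraint (explicit or implied) per pair of parameters. A valid covering array with $N$ tests is a matrix $\mathbf{M}\in\{0,1\}^{N\times k}$ (rows are tests, column $i$ gives the values of $X_i$) in which every row is feasible and, for every pair $i\neq j$ and every $(\alpha,\beta)\in\{0,1\}^2$ such that $(X_i,X_j)=(\alpha,\beta)$ is not forbidden, some row has value $\alpha$ in column $i$ and value $\beta$ in column $j$. An unconstrained pairwise covering array on $m$ parameters is a binary matrix with $m$ columns such that for every two distinct columns each of the four pairs in $\{0,1\}^2$ appears in at least one row. For a subset $P$ of the parameters, the induced constraint graph $G[P]=(P,E)$ has vertex set $P$ and an edge between each pair of parameters of $P$ that has a pairwise constraint (explicit or implied). It has a coherent partition $(P_0,P_1)$ if $P$ is the disjoint union of $P_0$ and $P_1$ and, for every pairwise constraint $(X_i,X_j)\neq(\alpha,\beta)$ between parameters of $P$, we have $X_i\in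 P_\alpha$ and $X_j\in P_\beta$. It is sparse split with a partition $(P_C,P_U)$ of $P$ if $G[P_C]$ is isomorphic to the clique $K_n$, $n:=|P_C|$, and there are no pairwise constraints between the parameters in $P_U$ and the parameters in $P$. *)

(* Defs.v *)
(* MathComp. *)
From mathcomp Require Import all_boot all_order all_algebra.
Set Implicit Arguments.
Unset Strict Implicit.
Unset Printing Implicit Defensive.

(* [((i, a), (j, b))] stands for the constraint (X_i, X_j) <> (a, b). *)
Definition constraint (k : nat) : Type := (('I_k * bool) * ('I_k * bool))%type.

Record problem (k : nat) := Problem {
  constraints : {set constraint k};
  constraints_neq :
    forall i a j b, ((i, a), (j, b)) \in constraints -> i != j
}.

Section Problem.
Variables (k : nat) (Q : problem k).

Definition feasible (x : 'rV[bool]_k) : bool :=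
  [forall c in constraints Q,
    (x ord0 c.1.1, x ord0 c.2.1) != (c.1.2, c.2.2)].

(* Explicit constraints are included: they fail at no feasible [x].  The clause
   [i != j] rules out the degenerate (X_i, X_i) = (0, 1). *)
Definition forbidden (i : 'I_k) (a : bool) (j : 'I_k) (b : bool) : bool :=
  (i != j) &&
  [forall x : 'rV[bool]_k, feasible x ==> ((x ord0 i, x ord0 j) != (a, b))].

Definition reduced : Prop :=
  (forall (i : 'I_k) (a : bool),
     exists2 x : 'rV[bool]_k, feasible x & x ord0 i = a) /\
  (forall (i j : 'I_k) (a b a' b' : bool),
     forbidden i a j b -> forbidden i a' j b' -> (a, b) = (a', b')).

Definition valid_covering_array (N : nat) (M : 'M[bool]_(N, k)) : Prop :=
  (forall r : 'I_N, feasible (row r M)) /\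
  (forall (i j : 'I_k) (a b : bool),
     i != j -> ~~ forbidden i a j b ->
     exists r : 'I_N, M r i = a /\ M r j = b).

Definition constraint_edge (i j : 'I_k) : bool :=
  [exists a : bool, exists b : bool, forbidden i a j b].

Definition constraint_graph (P : {set 'I_k}) : rel {i : 'I_k | i \in P} :=
  fun i j => constraint_edge (val i) (val j).

Definition coherent_partition (P P0 P1 : {set 'I_k}) : Prop :=
  [/\ P0 :|: P1 = P,
      [disjoint P0 & P1]
    & forall (i j : 'I_k) (a b : bool),
        i \in P -> j \in P -> forbidden i a j b ->
        i \in (if a then P1 else P0) /\ j \in (if b then P1 else P0)].

Definition graph_iso (T1 T2 : finType) (e1 : rel T1) (e2 : rel T2) : Prop :=
  exists2 f : T1 -> T2, bijective f & {mono f : x y / e1 x y >-> e2 x y}.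

Definition clique (n : nat) : rel 'I_n := fun x y => x != y.

Definition sparse_split (P PC PU : {set 'I_k}) : Prop :=
  [/\ PC :|: PU = P,
      [disjoint PC & PU],
      graph_iso (@constraint_graph PC) (@clique #|PC|)
    & forall u j : 'I_k, u \in PU -> j \in P -> ~~ constraint_edge u j].

End Problem.

Definition covering_array (R m : nat) (A : 'M[bool]_(R, m)) : Prop :=
  forall (i j : 'I_m) (a b : bool),
    i != j -> exists r : 'I_R, A r i = a /\ A r j = b.

(* Rows are partitioned as indices, so repeated tests count separately. *)
Definition row_partitionable (n R m : nat) (A : 'M[bool]_(R, m)) : Prop :=
  exists S : {set {set 'I_R}},
    [/\ partition S [set: 'I_R], #|S| = n
      & forall (B : {set 'I_R}) (i : 'I_m) (a : bool),
          B \in S -> exists2 r : 'I_R, r \in B & A r i = a].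

Definition partitionable_covering (n m R : nat) : Prop :=
  exists A : 'M[bool]_(R, m), covering_array A /\ row_partitionable n A.

Definition is_smallest (p : nat -> Prop) (R : nat) : Prop :=
  p R /\ forall R' : nat, p R' -> R <= R'.

Definition ones (N k : nat) (M : 'M[bool]_(N, k)) (i : 'I_k) : nat :=
  #|[set r : 'I_N | M r i]|.

(* Main.v *)
Require Import Defs.
From mathcomp Require Import all_boot all_order all_algebra.
From Stdlib Require Import Classical.
Set Implicit Arguments.
Unset Strict Implicit.
Unset Printing Implicit Defensive.

(** Each clique parameter [X_i], [i] in [PC], has one critical value: 0 if [i]
    is in [P0] and 1 if [i] is in [P1].  Coherence says that the constraint on
    any edge of the clique forbids exactly the pair of critical values, so a
    feasible test gives at most one clique parameter its critical value.  The
    sets [critical_tests M P1 i] of tests in which [X_i] is critical are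
    therefore pairwise disjoint ([disjoint_critical_tests]).

    A parameter [X_u] in [PU] is unconstrained with respect to [X_i], so a valid
    array must show the critical value of [X_i] together with both values of
    [X_u]; every critical set contains a test with [X_u = 0] and one with
    [X_u = 1] ([critical_tests_split]).  Distributing the remaining tests
    arbitrarily turns these [n] disjoint sets into a partition of the rows of
    the type required of the [m] columns of [PU] ([row_partitionable_disjoint]),
    and those columns form a covering array because [PU] carries no
    constraints.  Hence [N] is at least the least size of such an array, and
    that size is at least [2 * n] because each block has two tests.

    The bounds on the weights are counts in the same disjoint family: writing
    [s_i] for the size of the critical set of [X_i], the weight [w_i] is
    [N - s_i] on [P0] and [s_i] on [P1].  The other [n - 1] critical sets have
    two tests each, so [s_i <= N - 2 * (n - 1)]; and as the [s_i] sum to at most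
    [N], the sum of the [N - s_i] is at least [N * (n - 1)].

    The minimum is attained over a nonempty set of sizes, whatever the problem:
    [n] copies of all binary words of length [m] form an array of the required
    type ([ex_partitionable_covering]). *)

(** * Least sizes and disjoint families *)

Lemma ex_smallest (p : nat -> Prop) (R : nat) :
  p R -> exists R0, is_smallest p R0.
Proof.
move: R; apply: (well_founded_induction Wf_nat.lt_wf) => R IH pR.
case: (classic (exists2 R', p R' & R' < R)) => [[R' pR' /ltP/IH]|noR'].
  exact.
exists R; split=> // R' pR'; rewrite leqNgt; apply/negP=> ltR'.
by apply: noR'; exists R'.
Qed.

Section DisjointFamily.

Variables (I T : finType) (D : {set I}) (B : I -> {set T}).
Hypothesis disjB : {in D &, forall i j, j != i -> [disjoint B i & B j]}.

Lemma disjoint_family_inj i j (x : T) :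
  i \in D -> j \in D -> x \in B i -> x \in B j -> j = i.
Proof.
move=> Di Dj Bix Bjx; apply/eqP; apply: contraLR Bix => /(disjB Di Dj).
by move=> dis; rewrite (disjointFl dis).
Qed.

Lemma sum_card_disjoint : \sum_(i in D) #|B i| <= #|T|.
Proof.
under eq_bigr => i _ do rewrite -sum1_card.
rewrite (exchange_big_dep predT) //= -sum1_card; apply: leq_sum => x _.
rewrite sum1_card; apply/card_le1_eqP=> i j /andP[Di Bi] /andP[Dj Bj].
exact: (disjoint_family_inj Di Dj Bi Bj).
Qed.

Lemma card_disjoint_others (s : nat) i :
  {in D, forall j, s <= #|B j|} -> i \in D ->
  #|B i| + s * (#|D| - 1) <= #|T|.
Proof.
move=> leB Di; apply: leq_trans sum_card_disjoint.
rewrite (big_setD1 i) //= leq_add2l (cardsD1 i D) Di add1n subn1 /= mulnC.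
rewrite -sum_nat_const; apply: leq_sum => j /setD1P[_ Dj]; exact: leB.
Qed.

(** The complements add up to [#|D| * #|T|] minus the sizes of the members,
    and by disjointness those sizes use up [#|T|] at most once. *)
Lemma sum_card_complements :
  #|T| * (#|D| - 1) <= \sum_(i in D) (#|T| - #|B i|).
Proof.
have sumT : \sum_(i in D) (#|T| - #|B i|) + \sum_(i in D) #|B i| = #|D| * #|T|.
  rewrite -big_split /= -sum_nat_const; apply: eq_bigr => i _.
  by rewrite subnK ?max_card.
rewrite mulnBr muln1 mulnC -sumT leq_subLR addnC leq_add2r.
exact: sum_card_disjoint.
Qed.

End DisjointFamily.

(** * Arrays whose rows can be partitioned *)

(** The blocks need not be given as a partition: the rows left over by a
    disjoint family can all be added to one of its members, since enlarging a
    block preserves the values that occur in it. *)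
Lemma row_partitionable_disjoint (I : finType) (D : {set I}) (R m : nat)
    (A : 'M[bool]_(R, m)) (B : I -> {set 'I_R}) :
  0 < #|D| -> 0 < m ->
  {in D &, forall i j, j != i -> [disjoint B i & B j]} ->
  (forall i j a, i \in D -> exists2 r, r \in B i & A r j = a) ->
  row_partitionable #|D| A.
Proof.
case/card_gt0P=> i0 Di0 m_gt0 disjB splitB.
pose c r := odflt i0 [pick i in D | r \in B i].
pose C i := [set r | c r == i].
have Dc r : c r \in D by rewrite /c; case: pickP => [i /andP[]|].
have sBC i r : i \in D -> r \in B i -> r \in C i.
  move=> Di Bir; rewrite inE /c; case: pickP => [j /andP[Dj Bjr] | /(_ i)] /=.
    by rewrite (disjoint_family_inj disjB Di Dj Bir Bjr).
  by rewrite Di Bir.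
have splitC i j a : i \in D -> exists2 r, r \in C i & A r j = a.
  by move=> Di; have [r Bir <-] := splitB i j a Di; exists r; first exact: sBC.
have disjC : {in D &, forall i j, j != i -> [disjoint C i & C j]}.
  move=> i j _ _ neq_ji; rewrite -setI_eq0; apply/eqP/setP=> r; rewrite !inE.
  by apply/andP=> -[/eqP-> /eqP eq_ij]; rewrite eq_ij eqxx in neq_ji.
have C_neq0 i : i \in D -> C i != set0.
  move=> Di; have [r Cir _] := splitC i (Ordinal m_gt0) true Di.
  by apply/set0Pn; exists r.
have [partC injC] := indexed_partition disjC C_neq0.
exists [set C i | i in D]; split.
- suff <- : cover [set C i | i in D] = setT by [].
  apply/setP=> r; rewrite cover_imset !inE.
  by apply/bigcupP; exists (c r); rewrite ?inE.
- by rewrite card_in_imset.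
- by move=> _ j a /imsetP[i Di ->]; apply: splitC.
Qed.

Lemma two_values_card_gt1 (T : finType) (f : T -> bool) (B : {set T}) :
  (forall a, exists2 r, r \in B & f r = a) -> 1 < #|B|.
Proof.
move=> splitB; have [r Br fr] := splitB true; have [s Bs fs] := splitB false.
apply/card_gt1P; exists r, s; split=> //.
by apply/eqP=> eq_rs; rewrite eq_rs fs in fr.
Qed.

Lemma row_partitionable_size (n R m : nat) (A : 'M[bool]_(R, m)) :
  0 < m -> row_partitionable n A -> 2 * n <= R.
Proof.
move=> m_gt0 [S [partS <- splitS]].
have cardR : \sum_(B in S) #|B| = R.
  by rewrite -(card_partition partS) cardsT card_ord.
apply: leq_trans (eq_leq cardR); rewrite mulnC -sum_nat_const.
apply: leq_sum => B SB.
apply: (@two_values_card_gt1 _ (fun r => A r (Ordinal m_gt0))) => a.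
exact: splitS.
Qed.

(** Stacking [n] copies of the array of all binary words of length [m] gives a
    covering array in which each copy is a block. *)
Lemma ex_partitionable_covering (n m : nat) :
  0 < n -> 0 < m -> exists R, partitionable_covering n m R.
Proof.
move=> n_gt0 m_gt0; pose W := ('I_n * {ffun 'I_m -> bool})%type.
pose A := (\matrix_(r < #|{: W}|, j < m) (enum_val r).2 j)%R.
have rowA t (w : {ffun 'I_m -> bool}) :
    {r : 'I_#|{: W}| | (enum_val r).1 = t & forall j, A r j = w j}.
  by exists (enum_rank (t, w)) => [|j]; rewrite ?mxE enum_rankK.
exists #|{: W}|, A; split.
  move=> i j a b neq_ij.
  have [r _ Ar] := rowA (Ordinal n_gt0) [ffun l => if l == i then a else b].
  by exists r; rewrite !Ar !ffunE eqxx eq_sym (negbTE neq_ij).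
have cardI : #|[set: 'I_n]| = n by rewrite cardsT card_ord.
rewrite -[n in row_partitionable n]cardI.
apply: (@row_partitionable_disjoint _ _ _ _ _
          (fun t => [set r : 'I_#|{: W}| | (enum_val r).1 == t])) => //.
- by rewrite cardI.
- move=> s t _ _ neq_ts; rewrite -setI_eq0; apply/eqP/setP=> r; rewrite !inE.
  by apply/andP=> -[/eqP-> /eqP eq_st]; rewrite eq_st eqxx in neq_ts.
move=> t j a _; have [r rt Ar] := rowA t [ffun=> a].
by exists r; rewrite ?inE ?rt // Ar ffunE.
Qed.

(** * Critical values of the clique parameters *)

(** A parameter of [P] lies in exactly one of [P0] and [P1], so the boolean
    [i \in P1] is the value that [X_i] has in each constraint inside [P]. *)
Definition critical_tests (N k : nat) (M : 'M[bool]_(N, k)) (P1 : {set 'I_k})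
  (i : 'I_k) : {set 'I_N} := [set r | M r i == (i \in P1)].

Section Critical.

Variables (k : nat) (Q : problem k) (P P0 P1 PC PU : {set 'I_k}).
Hypothesis Pcoh : coherent_partition Q P P0 P1.
Hypothesis Psplit : sparse_split Q P PC PU.

Lemma split_sub_clique : PC \subset P.
Proof. by case: Psplit => <- _ _ _; apply: subsetUl. Qed.

Lemma split_sub_free : PU \subset P.
Proof. by case: Psplit => <- _ _ _; apply: subsetUr. Qed.

Lemma clique_edge i j : i \in PC -> j \in PC -> i != j -> constraint_edge Q i j.
Proof.
case: Psplit => _ _ [f bij_f mono_f] _ iC jC neq_ij.
rewrite -[constraint_edge Q i j]/(constraint_graph Q (Sub i iC) (Sub j jC)).
rewrite -mono_f /clique (inj_eq (bij_inj bij_f)).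
by apply: contraNneq neq_ij => /(congr1 val) /= ->.
Qed.

Lemma coherent_value i a j b :
  i \in P -> j \in P -> forbidden Q i a j b ->
  a = (i \in P1) /\ b = (j \in P1).
Proof.
case: Pcoh => _ dis coh iP jP /(coh _ _ _ _ iP jP).
have side h c : h \in (if c then P1 else P0) -> c = (h \in P1).
  by case: c => [-> //|h0]; rewrite (disjointFr dis h0).
by case=> /side-> /side->.
Qed.

(** An edge only says that some pair of values is forbidden; coherence
    identifies that pair. *)
Lemma clique_forbidden i j :
  i \in PC -> j \in PC -> i != j -> forbidden Q i (i \in P1) j (j \in P1).
Proof.
move=> iC jC neq_ij.
have [iP jP] := (subsetP split_sub_clique i iC, subsetP split_sub_clique j jC).
case/existsP: (clique_edge iC jC neq_ij) => a /existsP[b Fab].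
by have [<- <-] := coherent_value iP jP Fab.
Qed.

Lemma free_not_forbidden u j a b :
  u \in PU -> j \in P -> ~~ forbidden Q u a j b.
Proof.
case: Psplit => _ _ _ free uU jP; apply: contra (free u j uU jP) => Fab.
by apply/existsP; exists a; apply/existsP; exists b.
Qed.

Variables (N : nat) (M : 'M[bool]_(N, k)).
Hypothesis Mvalid : valid_covering_array Q M.

(** A test in two critical sets would show the pair of values that the clique
    edge between the two parameters forbids. *)
Lemma disjoint_critical_tests :
  {in PC &, forall i j, j != i ->
    [disjoint critical_tests M P1 i & critical_tests M P1 j]}.
Proof.
move=> i j iC jC neq_ji; rewrite -setI_eq0; apply/eqP/setP=> r; rewrite !inE.
apply/andP=> -[/eqP Mi /eqP Mj]; rewrite eq_sym in neq_ji.
case/andP: (clique_forbidden iC jC neq_ji) => _ /forallP/(_ (row r M)).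
by rewrite (proj1 Mvalid r) !mxE Mi Mj eqxx.
Qed.

(** The pair formed by the critical value of [X_i] and any value of an
    unconstrained [X_u] is not forbidden, so some test must cover it. *)
Lemma critical_tests_split i u a :
  i \in PC -> u \in PU -> exists2 r, r \in critical_tests M P1 i & M r u = a.
Proof.
move=> iC uU; have iP := subsetP split_sub_clique i iC.
have neq_ui : u != i.
  case: Psplit => _ dis _ _; apply: contraTneq uU => ->.
  by rewrite (disjointFr dis).
have [r [Mu Mi]] := proj2 Mvalid _ _ a (i \in P1) neq_ui
                          (free_not_forbidden _ _ uU iP).
by exists r; rewrite // inE Mi.
Qed.

Lemma critical_tests_gt1 i :
  0 < #|PU| -> i \in PC -> 1 < #|critical_tests M P1 i|.
Proof.
case/card_gt0P=> u uU iC.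
apply: (@two_values_card_gt1 _ (fun r => M r u)) => a.
exact: critical_tests_split.
Qed.

(** The columns of [PU] are the array that realizes the minimum in the bound on
    [N]; its blocks come from the critical sets. *)
Lemma free_columns_partitionable :
  0 < #|PC| -> 0 < #|PU| -> partitionable_covering #|PC| #|PU| N.
Proof.
move=> C_gt0 U_gt0.
exists (\matrix_(r < N, j < #|PU|) M r (enum_val j))%R; split.
  move=> i j a b neq_ij.
  have neq_uv : enum_val i != enum_val j by rewrite (inj_eq enum_val_inj).
  have vP := subsetP split_sub_free _ (enum_valP j).
  have [r [Mu Mv]] := proj2 Mvalid _ _ a b neq_uv
                            (free_not_forbidden _ _ (enum_valP i) vP).
  by exists r; rewrite !mxE.
apply: (row_partitionable_disjoint C_gt0 U_gt0 disjoint_critical_tests).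
move=> i j a iC; have [r Br Mr] := critical_tests_split a iC (enum_valP j).
by exists r; rewrite ?mxE.
Qed.

Lemma ones_critical0 i :
  i \in P0 -> ones M i = N - #|critical_tests M P1 i|.
Proof.
case: Pcoh => _ dis _ i0; rewrite /ones cardsCs card_ord.
congr (_ - #|pred_of_set _|).
by apply/setP=> r; rewrite !inE (disjointFr dis i0) eqbF_neg.
Qed.

Lemma ones_critical1 i : i \in P1 -> ones M i = #|critical_tests M P1 i|.
Proof. by move=> i1; apply: eq_card => r; rewrite !inE i1 eqb_id. Qed.

Lemma clique_sideD : PC :\: P0 = PC :&: P1.
Proof.
case: Pcoh => UP dis _; apply/setP=> i; rewrite !inE andbC.
case iC: (i \in PC) => //=; have := subsetP split_sub_clique i iC.
rewrite -UP inE; case i0: (i \in P0) => //=.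
by rewrite (disjointFr dis i0).
Qed.

Lemma sum_clique_ones :
  \sum_(i in PC :&: P0) ones M i + \sum_(i in PC :&: P1) (N - ones M i)
    = \sum_(i in PC) (N - #|critical_tests M P1 i|).
Proof.
rewrite [RHS](big_setID P0) /= clique_sideD.
congr (_ + _); apply: eq_bigr => i /setIP[_ iP].
  exact: ones_critical0.
by rewrite ones_critical1.
Qed.

End Critical.

Theorem theorem3 (k : nat) (Q : problem k) (P P0 P1 PC PU : {set 'I_k})
    (Qred : reduced Q)
    (Pcoh : coherent_partition Q P P0 P1)
    (Psplit : sparse_split Q P PC PU)
    (n_ge3 : 3 <= #|PC|)
    (m_ge1 : 1 <= #|PU|) :
  let n := #|PC| in
  let m := #|PU| in
  exists alpha : nat,
    is_smallest (partitionable_covering n m) (2 * n + alpha) /\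
    forall (N : nat) (M : 'M[bool]_(N, k)), valid_covering_array Q M ->
      [/\ N >= 2 * n + alpha,
          forall i : 'I_k, i \in PC :&: P0 -> ones M i >= 2 * (n - 1),
          forall i : 'I_k, i \in PC :&: P1 -> ones M i <= N - 2 * (n - 1)
        & \sum_(i in PC :&: P0) ones M i + \sum_(i in PC :&: P1) (N - ones M i)
            >= (2 * n + alpha) * (n - 1)].
Proof.
move=> n m; have n_gt0 : 0 < n by apply: leq_trans n_ge3.
have [R0 exR0] := ex_partitionable_covering n_gt0 m_ge1.
have [R Rmin] := ex_smallest exR0.
have leR : 2 * n <= R.
  by case: Rmin => -[A [_ partA]] _; apply: row_partitionable_size partA.
exists (R - 2 * n); rewrite subnKC //; split=> // N M Mvalid.
have leRN : R <= N.
  exact: (proj2 Rmin _ (free_columns_partitionable Pcoh Psplit Mvalid _ _)).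
have disjB := disjoint_critical_tests Pcoh Psplit Mvalid.
have others i : i \in PC -> #|critical_tests M P1 i| + 2 * (n - 1) <= N.
  move=> iC; apply: leq_trans (eq_leq (card_ord N)).
  apply: (card_disjoint_others disjB _ iC) => j jC.
  exact: (critical_tests_gt1 _ Psplit Mvalid).
split=> //.
- move=> i /setIP[iC i0]; rewrite (ones_critical0 Pcoh _ i0).
  by rewrite leq_subRL ?others // -[leqRHS]card_ord max_card.
- move=> i /setIP[iC i1]; rewrite (ones_critical1 _ i1).
  by rewrite -(addnK (2 * (n - 1)) #|_|) leq_sub2r ?others.
rewrite (sum_clique_ones Pcoh Psplit).
apply: leq_trans (leq_mul leRN (leqnn _)) _.
by have := sum_card_complements disjB; rewrite card_ord.
Qed.
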